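(* Let $\Gamma$ be a finite simple graph. Then the parts (vertices) of the complete skeleton $\Omega(\Gamma)$ are exactly the following: each structural equivalence class of $\Gamma$ that induces a complete subgraph of $\Gamma$ (including singleton classes), and, for each structural equivalence class of size at least two that is an independent set, each of its vertices as a separate singleton part $K_1$ (these $K_1$ parts are pairwise non-adjacent, share the same neighbors, and together form a completely disconnected equivalence class).
   Context: Two vertices $u,v$ of $\Gamma$ are structurally equivalent if the transposition $(u\,v)$ (swapping $u,v$, fixing other vertices) is an automorphism of $\Gamma$; this is an equivalence relation whose classes are the structural equivalence classes. Consider partitions of $V(\Gamma)$ into nonempty parts such that each part induces a complete subgraph of $\Gamma$ and, for any two distinct parts $P,Q$, either every vertex of $P$ is adjacent to every vertex of $Q$ or no vertex of $P$ is adjacent to any vertex of $Q$. The complete skeleton $\Omega(\Gamma)$ is such a partition with the minimum possible number of parts, viewed as a graph whose vertices are the parts (each part of size $a$ labelled $K_a$), two parts being adjacent iff they are completely joined. *)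

(* Defs.v *)
From mathcomp Require Import all_boot all_fingroup.

Set Implicit Arguments.
Unset Strict Implicit.
Unset Printing Implicit Defensive.

(* A finite simple graph is a symmetric irreflexive relation on a finType. *)

Section StructuralEquivalence.

Variables (T : finType) (e : rel T).

Definition automorphism (s : {perm T}) : bool :=
  [forall x, forall y, e (s x) (s y) == e x y].

Definition struct_equiv (u v : T) : bool := automorphism (tperm u v).

Definition struct_classes : {set {set T}} :=
  equivalence_partition struct_equiv [set: T].

(* The same notions for a graph whose vertices carry labels, which the
   automorphisms must preserve. Labels matter for the skeleton: if the graph
   has two isolated vertices and one isolated edge, then the skeleton has three
   isolated vertices K_1, K_1, K_2, of which only the two K_1 form a class. *)
Definition labelled_automorphism (l : T -> nat) (s : {perm T}) : bool :=
  automorphism s && [forall x, l (s x) == l x].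

Definition labelled_struct_equiv (l : T -> nat) (u v : T) : bool :=
  labelled_automorphism l (tperm u v).

Definition labelled_struct_classes (l : T -> nat) : {set {set T}} :=
  equivalence_partition (labelled_struct_equiv l) [set: T].

Definition complete (A : {set T}) : bool :=
  [forall x in A, forall y in A, (x != y) ==> e x y].

Definition independent (A : {set T}) : bool :=
  [forall x in A, forall y in A, ~~ e x y].

Definition joined (A B : {set T}) : bool :=
  [forall x in A, forall y in B, e x y].

Definition unjoined (A B : {set T}) : bool :=
  [forall x in A, forall y in B, ~~ e x y].

Lemma automorphismM s t :
  automorphism s -> automorphism t -> automorphism (s * t)%g.
Proof.
move=> /forallP Hs /forallP Ht; apply/forallP => x; apply/forallP => y.
rewrite !permM (eqP (forallP (Ht _) _)); exact: (forallP (Hs x) y).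
Qed.

Lemma struct_equiv_equivalence : equivalence_rel struct_equiv.
Proof.
have sym u v : struct_equiv u v = struct_equiv v u.
  by rewrite /struct_equiv tpermC.
have refl u : struct_equiv u u.
  by rewrite /struct_equiv tperm1; apply/forallP=> x; apply/forallP=> y;
    rewrite !perm1.
have trans v u w : struct_equiv u v -> struct_equiv v w -> struct_equiv u w.
  have [->|neuw] := eqVneq u w; first by rewrite refl.
  have [->//|neuv] := eqVneq u v; have [<-//|nevw] := eqVneq v w.
  move=> Huv Hvw; rewrite /struct_equiv.
  have -> : tperm u w = (tperm v w * (tperm u v * tperm v w))%g.
    have : (tperm u v ^ tperm v w)%g = tperm u w.
      by rewrite tpermJ tpermL tpermD // eq_sym.
    by rewrite conjgE tpermV => ->.
  by do 2!apply: automorphismM => //.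
move=> u v w; split=> [|uv]; first exact: refl.
by apply/idP/idP; apply: trans => //; rewrite sym.
Qed.

End StructuralEquivalence.

Section CompleteSkeleton.

Variables (T : finType) (e : rel T).

Definition complete_partition (P : {set {set T}}) : bool :=
  [&& partition P [set: T],
      [forall A in P, complete e A]
    & [forall A in P, forall B in P,
         (A != B) ==> joined e A B || unjoined e A B]].

Definition complete_skeleton (P : {set {set T}}) : Prop :=
  complete_partition P /\
  (forall Q : {set {set T}}, complete_partition Q -> #|P| <= #|Q|).

Lemma complete_skeleton_exists : exists P, complete_skeleton P.
Proof.
have H : complete_partition [set [set x] | x in [set: T]].
  apply/and3P; split.
  - apply/and3P; split.
    + by rewrite /cover; apply/eqP/setP=> x; rewrite inE; apply/bigcupP;
        exists [set x]; rewrite ?set11 // imset_f ?inE.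
    + apply/trivIsetP=> _ _ /imsetP[x _ ->] /imsetP[y _ ->] ne.
      by rewrite disjoints1 inE; apply: contra ne => /eqP->.
    + by apply/imsetP=> -[x _ /setP/(_ x)]; rewrite !inE eqxx.
  - apply/forall_inP=> _ /imsetP[x _ ->].
    apply/forall_inP=> y /set1P->; apply/forall_inP=> z /set1P->.
    by rewrite eqxx.
  - apply/forall_inP=> _ /imsetP[x _ ->]; apply/forall_inP=> _ /imsetP[y _ ->].
    apply/implyP=> _; case: (boolP (e x y)) => exy; apply/orP; [left|right];
    by apply/forall_inP=> ? /set1P->; apply/forall_inP=> ? /set1P->.
case: (arg_minnP (fun P : {set {set T}} => #|P|) H) => P HP minP.
by exists P; split.
Qed.

(* The complete skeleton viewed as a graph: its vertices are the parts of [P],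
   and a part of size [a] is labelled [K_a], encoded by the number [a]. *)
Definition skel_vertex (P : {set {set T}}) : finType :=
  {A : {set T} | A \in P}.

Definition skel_adj (P : {set {set T}}) : rel (skel_vertex P) :=
  fun A B => (A != B) && joined e (val A) (val B).

Definition skel_label (P : {set {set T}}) (A : skel_vertex P) : nat :=
  #|val A|.

Definition K1_parts (P : {set {set T}}) (C : {set T}) : {set skel_vertex P} :=
  [set A : skel_vertex P | [exists x in C, val A == [set x]]].

End CompleteSkeleton.

(* Main.v *)
Require Import Defs.
From mathcomp Require Import all_boot all_fingroup.

(** Call u and v closed twins when they are structurally equivalent and are
    equal or adjacent. Vertices in the same part of a complete partition are
    closed twins, and the closed-twin classes themselves form a complete
    partition; hence they are the unique complete partition with the fewest
    parts. A structural equivalence class is complete or independent: it is a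
    single closed-twin class in the first case, and splits into singletons in
    the second. *)

Set Implicit Arguments.
Unset Strict Implicit.
Unset Printing Implicit Defensive.

Section ClosedTwins.

Variables (T : finType) (e : rel T).
Hypotheses (e_sym : symmetric e) (e_irr : irreflexive e).

(** Swapping [u] and [v] affects only pairs that meet [{u, v}]. The pair of [u] and [v] itself is
    preserved by symmetry and loops by irreflexivity, so only the pairs with one end outside
    matter. *)
Lemma struct_equivP u v :
  reflect (forall w, w != u -> w != v -> e u w = e v w) (struct_equiv e u v).
Proof.
apply: (iffP forallP) => [aut w wu wv | tw x].
  by have /forallP/(_ w)/eqP := aut u; rewrite tpermL tpermD // eq_sym.
apply/forallP => y; apply/eqP.
case: (tpermP u v x) => [->|->|/eqP xu /eqP xv];
  case: (tpermP u v y) => [->|->|/eqP yu /eqP yv]; rewrite ?e_irr //.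
- by rewrite tw.
- by rewrite tw.
- by rewrite !(e_sym x) tw.
- by rewrite !(e_sym x) tw.
Qed.

Lemma struct_equiv_refl u : struct_equiv e u u.
Proof. by apply/struct_equivP. Qed.

Lemma struct_equiv_sym u v : struct_equiv e u v = struct_equiv e v u.
Proof. by rewrite /struct_equiv tpermC. Qed.

Lemma struct_equiv_trans v u w :
  struct_equiv e u v -> struct_equiv e v w -> struct_equiv e u w.
Proof. by case: (struct_equiv_equivalence e u v w) => _ tr /tr ->. Qed.

Lemma struct_classesP C :
  reflect (exists x, C = [set y | struct_equiv e x y]) (C \in struct_classes e).
Proof.
apply: (iffP imsetP) => [[x _ ->] | [x ->]]; exists x => //;
  by apply/setP => y; rewrite !inE.
Qed.

Lemma struct_class_eq C x :
  C \in struct_classes e -> x \in C -> C = [set y | struct_equiv e x y].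
Proof.
case/struct_classesP => z ->; rewrite inE => zx; apply/setP => y; rewrite !inE.
by case: (struct_equiv_equivalence e z x y) => _ ->.
Qed.

(** Equivalently, [u] and [v] have the same closed neighbourhood. *)
Definition closed_twin (u v : T) : bool :=
  struct_equiv e u v && ((u == v) || e u v).

Definition twin_class (x : T) : {set T} := [set y | closed_twin x y].

Lemma closed_twin_refl x : closed_twin x x.
Proof. by rewrite /closed_twin struct_equiv_refl eqxx. Qed.

Lemma closed_twin_sym x y : closed_twin x y = closed_twin y x.
Proof. by rewrite /closed_twin struct_equiv_sym eq_sym e_sym. Qed.

(* The transposition swapping v and w fixes u, so it carries the edge uv to
   the edge uw. *)
Lemma adj_struct_equiv u v w :
  struct_equiv e v w -> u != w -> e u v -> e u w.
Proof.
move=> /struct_equivP vw uw; have [->|uv] := eqVneq u v; first by rewrite e_irr.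
by rewrite !(e_sym u) vw.
Qed.

Lemma closed_twin_trans v u w :
  closed_twin u v -> closed_twin v w -> closed_twin u w.
Proof.
move=> /andP[suv auv] /andP[svw avw].
rewrite /closed_twin (struct_equiv_trans suv svw) /=.
have [//|uw] := eqVneq u w.
case/predU1P: auv avw => [<-|euv _]; first by rewrite (negbTE uw).
exact: adj_struct_equiv svw uw euv.
Qed.

Lemma twin_class_eq x y : closed_twin x y -> twin_class x = twin_class y.
Proof.
move=> xy; apply/setP => z; rewrite !inE; apply/idP/idP; apply: closed_twin_trans => //.
by rewrite closed_twin_sym.
Qed.

Lemma complete_partition_twin_classes :
  complete_partition e [set twin_class x | x in [set: T]].
Proof.
apply/and3P; split.
- apply/and3P; split.
  + apply/eqP/setP => x; rewrite inE; apply/bigcupP.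
    by exists (twin_class x); rewrite ?imset_f // inE closed_twin_refl.
  + apply/trivIsetP => _ _ /imsetP[x _ ->] /imsetP[y _ ->]; apply: contraR.
    rewrite -setI_eq0 => /set0Pn[z]; rewrite !inE => /andP[xz yz].
    by rewrite (twin_class_eq xz) (twin_class_eq yz).
  + apply/imsetP => -[x _ /setP/(_ x)]; by rewrite !inE closed_twin_refl.
- apply/forall_inP => _ /imsetP[x _ ->].
  apply/forall_inP => y; rewrite inE closed_twin_sym => xy.
  apply/forall_inP => z; rewrite inE => xz.
  have /andP[_] := closed_twin_trans xy xz.
  by case: (y == z).
- apply/forall_inP => _ /imsetP[x _ ->]; apply/forall_inP => _ /imsetP[y _ ->].
  apply/implyP => ne.
  (* The endpoints are moved one at a time by structural equivalence. This requires the fixed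
     endpoint to differ from both vertices being exchanged, which [nec] derives from the classes
     being distinct. *)
  have exy_const a b : closed_twin x a -> closed_twin y b -> e a b = e x y.
    move=> xa yb.
    have nec u v : closed_twin x u -> closed_twin y v -> u != v.
      move=> xu yv; apply: contra_neq ne => uv.
      by rewrite (twin_class_eq xu) uv -(twin_class_eq yv).
    have /andP[/struct_equivP sxa _] := xa.
    have /andP[/struct_equivP syb _] := yb.
    rewrite -sxa; last 2 first.
    + by rewrite eq_sym nec // closed_twin_refl.
    + by rewrite eq_sym nec.
    rewrite !(e_sym x) syb //; first by rewrite nec // closed_twin_refl.
    by rewrite nec // closed_twin_refl.
  case: (boolP (e x y)) => exy; apply/orP; [left | right];
    apply/forall_inP => a; rewrite inE => xa;
    by apply/forall_inP => b; rewrite inE => yb; rewrite (exy_const a b).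
Qed.

(** * Arbitrary complete partitions *)

Section Partition.

Variables (P : {set {set T}}) (compP : complete_partition e P).

Let partP : partition P [set: T]. Proof. by case/and3P: compP. Qed.

Lemma complete_partition_pblock x : pblock P x \in P.
Proof. by apply: pblock_mem; rewrite (cover_partition partP). Qed.

Lemma complete_partition_mem_pblock x : x \in pblock P x.
Proof. by rewrite mem_pblock (cover_partition partP). Qed.

Lemma complete_partition_eq A B x :
  A \in P -> B \in P -> x \in A -> x \in B -> A = B.
Proof.
have trivP := partition_trivIset partP.
by move=> AP BP xA xB; rewrite -(def_pblock trivP AP xA) (def_pblock trivP BP xB).
Qed.

(** Adjacency between distinct parts is all or nothing, so one pair of representatives decides
    it. *)
Lemma complete_partition_joined A B a b :
  A \in P -> B \in P -> A != B -> a \in A -> b \in B -> joined e A B = e a b.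
Proof.
case/and3P: compP => _ _ /forall_inP H AP BP ne aA bB.
have /forall_inP/(_ B BP)/implyP/(_ ne) := H A AP.
case/orP => j.
  by rewrite j; have /forall_inP/(_ b bB)-> := forall_inP j a aA.
have /forall_inP/(_ b bB)/negbTE nab := forall_inP j a aA.
rewrite nab; apply/negP => /forall_inP/(_ a aA)/forall_inP/(_ b bB).
by rewrite nab.
Qed.

(** A third vertex inside [A] is adjacent to both [x] and [y] by completeness; one outside lies in
    another part, which is joined to all of [A] or to none of it. *)
Lemma complete_partition_twin A x y :
  A \in P -> x \in A -> y \in A -> closed_twin x y.
Proof.
move=> AP xA yA; have complA u v : u \in A -> v \in A -> u != v -> e u v.
  case/and3P: compP => _ /forall_inP/(_ A AP)/forall_inP cA _ uA vA.
  by have /forall_inP/(_ v vA)/implyP := cA u uA.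
apply/andP; split; last first.
  by have [//|ne] := eqVneq x y; rewrite complA.
apply/struct_equivP => w wx wy.
have [wA|wA] := boolP (w \in A); first by rewrite !complA // eq_sym.
have wB := complete_partition_mem_pblock w.
have BP := complete_partition_pblock w.
have neq : A != pblock P w by apply: contraNneq wA => ->.
by rewrite -(complete_partition_joined AP BP neq xA wB)
           (complete_partition_joined AP BP neq yA wB).
Qed.

End Partition.

(** * Minimal complete partitions *)

Lemma complete_skeleton_part P A x :
  complete_skeleton e P -> A \in P -> x \in A -> A = twin_class x.
Proof.
move=> [compP minP] AP xA.
(* Saturating [B] under the twin relation gives the class of any of its elements without choosing a
   representative. *)
pose f (B : {set T}) := [set y | [exists z in B, closed_twin z y]].
have fE B z : B \in P -> z \in B -> f B = twin_class z.
  move=> BP zB; apply/setP => y; rewrite !inE; apply/exists_inP/idP.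
    by case=> t tB; apply: closed_twin_trans; apply: complete_partition_twin BP _ _.
  by exists z.
(* Sending a part to the closed-twin class containing it maps P onto the set
   of these classes, hence is injective because P is minimal. *)
have f_inj : {in P &, injective f}.
  apply/imset_injP; rewrite eqn_leq leq_imset_card.
  apply: leq_trans (minP _ complete_partition_twin_classes) _.
  apply: subset_leq_card; apply/subsetP => _ /imsetP[z _ ->].
  have [zP zz] := (complete_partition_pblock compP z, complete_partition_mem_pblock compP z).
  by rewrite -(fE _ _ zP zz) imset_f.
apply/setP => y; rewrite inE; apply/idP/idP => [yA | xy].
  exact: complete_partition_twin AP xA yA.
have [yP yy] := (complete_partition_pblock compP y, complete_partition_mem_pblock compP y).
suff -> : A = pblock P y by [].
by apply: f_inj => //; rewrite (fE _ _ AP xA) (fE _ _ yP yy) (twin_class_eq xy).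
Qed.

(** The description of the parts does not depend on [P], so the complete skeleton is unique. *)
Lemma complete_skeletonP P A :
  complete_skeleton e P -> reflect (exists x, A = twin_class x) (A \in P).
Proof.
move=> skelP; have [compP _] := skelP.
apply: (iffP idP) => [AP | [x ->]].
  have [partP _ _] := and3P compP.
  have /set0Pn[x xA] : A != set0.
    by apply: contraTneq AP => ->; have [_ _] := and3P partP.
  by exists x; apply: complete_skeleton_part skelP AP xA.
have xP := complete_partition_pblock compP x.
by rewrite -(complete_skeleton_part skelP xP (complete_partition_mem_pblock compP x)).
Qed.

(** * Structural equivalence classes and their closed-twin classes *)

Lemma twin_class_complete C x :
  C \in struct_classes e -> x \in C -> complete e C -> twin_class x = C.
Proof.
move=> CS xC /forall_inP/(_ x xC)/forall_inP cC; apply/setP => y.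
have inC : (y \in C) = struct_equiv e x y by rewrite (struct_class_eq CS xC) inE.
rewrite inE /closed_twin -inC; have [yC|//] := boolP (y \in C).
by have /implyP := cC y yC; case: eqVneq => //= _ ->.
Qed.

Lemma twin_class_independent C x :
  C \in struct_classes e -> x \in C -> independent e C -> twin_class x = [set x].
Proof.
move=> CS xC /forall_inP/(_ x xC)/forall_inP iC; apply/setP => y.
have inC : (y \in C) = struct_equiv e x y by rewrite (struct_class_eq CS xC) inE.
rewrite !inE /closed_twin -inC eq_sym; have [->|ne] := eqVneq y x; first by rewrite xC.
by apply/negbTE; rewrite negb_and -implybE; apply/implyP/iC.
Qed.

(** A single edge in [C] makes [C] complete: structural equivalences carry its endpoints, one at a
    time, to any two distinct vertices of [C]. *)
Lemma struct_class_complete_or_independent C :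
  C \in struct_classes e -> complete e C || independent e C.
Proof.
move=> CS; have [|] := boolP (independent e C); first by rewrite orbT.
rewrite orbF => /forall_inPn[a aC /forall_inPn[b bC]]; rewrite negbK => ab.
have sC u v : u \in C -> v \in C -> struct_equiv e u v.
  by move=> uC; rewrite (struct_class_eq CS uC) inE.
apply/forall_inP => x xC; apply/forall_inP => y yC; apply/implyP => xy.
(* The edge [ab] is moved to [xb] and then to [xy]. The intermediate pair degenerates when [x = b];
   in that case moving [a] to [y] suffices. *)
have [xb|xb] := eqVneq x b.
  by apply: (adj_struct_equiv (sC a y aC yC) xy); rewrite xb e_sym.
apply: (adj_struct_equiv (sC b y bC yC) xy).
rewrite e_sym; apply: (adj_struct_equiv (sC a x aC xC)); first by rewrite eq_sym.
by rewrite e_sym.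
Qed.

Lemma complete_skeleton_mem P A :
  complete_skeleton e P ->
  A \in P <->
  (A \in struct_classes e /\ complete e A) \/
  (exists C : {set T}, exists x : T,
     [/\ C \in struct_classes e, 1 < #|C|, independent e C, x \in C
       & A = [set x]]).
Proof.
move=> skelP; split=> [/(complete_skeletonP _ skelP)[x ->] | H]; last first.
  apply/(complete_skeletonP _ skelP).
  case: H => [[AS cA] | [C [x [CS _ iC xC ->]]]]; last first.
    by exists x; rewrite (twin_class_independent CS xC iC).
  have [x Ax] := struct_classesP _ AS.
  by exists x; rewrite (twin_class_complete AS _ cA) // Ax inE struct_equiv_refl.
pose C := [set y | struct_equiv e x y].
have xC : x \in C by rewrite inE struct_equiv_refl.
have CS : C \in struct_classes e by apply/struct_classesP; exists x.
have [cC|ncC] := boolP (complete e C).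
  by left; rewrite (twin_class_complete CS xC cC).
have iC : independent e C.
  by have := struct_class_complete_or_independent CS; rewrite (negbTE ncC).
right; exists C, x; split=> //; last exact: twin_class_independent CS xC iC.
(* Singleton classes count as complete, so a class that is not complete has at least two
   vertices. *)
rewrite ltnNge; apply: contra ncC => /card_le1P C1.
apply/forall_inP => a aC; apply/forall_inP => b.
by rewrite (C1 a aC) inE => /eqP->; rewrite eqxx.
Qed.

(** With irreflexivity, this lets [struct_equivP] be applied to the skeleton as a graph in its own
    right. *)
Lemma skel_adj_sym P : symmetric (@skel_adj T e P).
Proof.
move=> A B; rewrite /skel_adj eq_sym; congr (_ && _).
apply/forall_inP/forall_inP => H x xA; apply/forall_inP => y yB;
  by rewrite e_sym; have /forall_inP := H y yB; apply.
Qed.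

Lemma skel_adj_irr P : irreflexive (@skel_adj T e P).
Proof. by move=> A; rewrite /skel_adj eqxx. Qed.

Lemma skel_adjE P (A B : skel_vertex P) a b :
  complete_partition e P -> a \in val A -> b \in val B ->
  skel_adj e A B = (A != B) && e a b.
Proof.
move=> compP aA bB; rewrite /skel_adj; have [//|ne] := eqVneq A B.
rewrite /= (complete_partition_joined compP _ _ _ aA bB) //; exact: valP.
Qed.

End ClosedTwins.

(** * The singleton parts of an independent class, inside the skeleton graph *)

Section IndependentClass.

Variables (T : finType) (e : rel T) (P : {set {set T}}) (C : {set T}).
Hypotheses (e_sym : symmetric e) (e_irr : irreflexive e).
Hypotheses (skelP : complete_skeleton e P) (CS : C \in struct_classes e).
Hypothesis iC : independent e C.

Let compP : complete_partition e P. Proof. by case: skelP. Qed.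

Lemma K1_partsP (A : skel_vertex P) :
  reflect (exists2 x, x \in C & val A = [set x]) (A \in K1_parts P C).
Proof.
by rewrite inE; apply: (iffP exists_inP) => -[x xC /eqP Ax]; exists x.
Qed.

Lemma K1_part_ex x : x \in C -> exists2 A : skel_vertex P,
  A \in K1_parts P C & val A = [set x].
Proof.
move=> xC; have xP : [set x] \in P.
  apply/(complete_skeletonP e_sym e_irr _ skelP).
  by exists x; rewrite (twin_class_independent CS xC iC).
by exists (Sub [set x] xP); rewrite ?SubK //; apply/K1_partsP; exists x.
Qed.

Lemma bigcup_K1_parts : \bigcup_(A in K1_parts P C) val A = C.
Proof.
apply/setP => x; apply/bigcupP/idP => [[A /K1_partsP[y yC ->]] | xC].
  by rewrite inE => /eqP->.
by have [A AK Ax] := K1_part_ex xC; exists A; rewrite // Ax set11.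
Qed.

Lemma independent_K1_parts : independent (@skel_adj T e P) (K1_parts P C).
Proof.
apply/forall_inP => A /K1_partsP[x xC Ax].
apply/forall_inP => B /K1_partsP[y yC By].
rewrite (skel_adjE (a := x) (b := y) compP) ?Ax ?By ?set11 // negb_and.
by have /forall_inP/(_ y yC)-> := forall_inP iC x xC; rewrite orbT.
Qed.

Lemma skel_vertex_neq (A D : skel_vertex P) x z :
  x \in val A -> z \in val D -> D != A -> z != x.
Proof.
move=> xA zD; apply: contra_neq => zx; apply: val_inj.
by rewrite zx in zD; exact: (complete_partition_eq compP (valP D) (valP A) zD xA).
Qed.

(** If [D] is [A] or [B], both sides are false by independence. Otherwise a vertex of [D] differs
    from the vertices of [A] and [B], which are structurally equivalent and so agree on it. *)
Lemma skel_adj_K1_parts :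
  {in K1_parts P C &, forall A B,
     forall D : skel_vertex P, skel_adj e A D = skel_adj e B D}.
Proof.
move=> A B AK BK D; have indep := independent_K1_parts.
have nadj F G : F \in K1_parts P C -> G \in K1_parts P C -> skel_adj e F G = false.
  by move=> FK GK; apply/negbTE; have /forall_inP := forall_inP indep F FK; apply.
have [->|DA] := eqVneq D A; first by rewrite !nadj.
have [->|DB] := eqVneq D B; first by rewrite !nadj.
case/K1_partsP: AK => x xC Ax; case/K1_partsP: BK => y yC By.
have [xA yB] : x \in val A /\ y \in val B by rewrite Ax By !set11.
have [z zD] : exists z, z \in val D.
  apply/set0Pn; apply: contraTneq (valP D) => ->.
  by case/and3P: compP => /and3P[].
rewrite (skel_adjE compP xA zD) (skel_adjE compP yB zD).
rewrite !(eq_sym _ D) DA DB /=.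
have /(struct_equivP e_sym e_irr) sxy : struct_equiv e x y.
  by move: yC; rewrite (struct_class_eq CS xC) inE.
by rewrite sxy // (skel_vertex_neq xA zD, skel_vertex_neq yB zD).
Qed.

Lemma K1_parts_labelled_class :
  K1_parts P C \in
    labelled_struct_classes (@skel_adj T e P) (@skel_label T P).
Proof.
have skel_struct_equivP := struct_equivP (skel_adj_sym e_sym (P := P))
                                         (skel_adj_irr e (P := P)).
have [c cC] : exists c, c \in C.
  have [c ->] := struct_classesP _ _ CS.
  by exists c; rewrite inE struct_equiv_refl.
have [A AK Ac] := K1_part_ex cC.
apply/imsetP; exists A => //; apply/setP => B; rewrite in_set in_setT /=.
apply/idP/andP => [BK | [/skel_struct_equivP sAB /forallP/(_ A)/eqP]].
  split; first by apply/skel_struct_equivP => D _ _; apply: skel_adj_K1_parts.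
  have label1 D : D \in K1_parts P C -> skel_label D = 1.
    by case/K1_partsP => x _ Dx; rewrite /skel_label Dx cards1.
  apply/forallP => D; apply/eqP.
  by case: tpermP => [->|->|//]; rewrite !label1.
(* Preservation of the label at [A] forces [B] to have one vertex as well. Without labels, [B] could
   be a larger part with the same neighbours. *)
rewrite tpermL /skel_label Ac cards1 => /eqP/cards1P[y By].
have [cA yB] : c \in val A /\ y \in val B by rewrite Ac By !set11.
apply/K1_partsP; exists y => //.
(* Equivalence descends from the skeleton to the graph: the part of [w] differs from the singletons
   [A] and [B], and its adjacency to them is that of [w] to [c] and [y]. *)
rewrite (struct_class_eq CS cC) inE; apply/(struct_equivP e_sym e_irr) => w wc wy.
have wP := complete_partition_pblock compP w.
pose D : skel_vertex P := Sub (pblock P w) wP.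
have wD : w \in val D by rewrite SubK (complete_partition_mem_pblock compP).
have DA : D != A by apply: contraNneq wc => DA; rewrite DA Ac inE in wD.
have DB : D != B by apply: contraNneq wy => DB; rewrite DB By inE in wD.
have := sAB D DA DB.
by rewrite (skel_adjE compP cA wD) (skel_adjE compP yB wD) !(eq_sym _ D) DA DB.
Qed.

End IndependentClass.

Theorem theorem4p2 (T : finType) (e : rel T)
    (e_sym : symmetric e) (e_irr : irreflexive e)
    (P : {set {set T}}) (skelP : complete_skeleton e P) :
  (forall A : {set T},
     A \in P <->
     (A \in struct_classes e /\ complete e A) \/
     (exists C : {set T}, exists x : T,
        [/\ C \in struct_classes e, 1 < #|C|, independent e C, x \in C
          & A = [set x]])) /\
  (forall C : {set T},
     C \in struct_classes e -> 1 < #|C| -> independent e C ->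
     [/\ \bigcup_(A in K1_parts P C) val A = C,
         {in K1_parts P C &, forall A B, A != B -> ~~ skel_adj e A B},
         {in K1_parts P C &, forall A B,
            forall D : skel_vertex P, skel_adj e A D = skel_adj e B D},
         K1_parts P C \in
           labelled_struct_classes (@skel_adj T e P) (@skel_label T P)
       & independent (@skel_adj T e P) (K1_parts P C)]).
Proof.
split=> [A | C CS _ iC]; first exact: complete_skeleton_mem.
have indep := independent_K1_parts skelP iC.
split=> //; first exact: (bigcup_K1_parts e_sym e_irr skelP CS iC).
- by move=> A B AK BK _; have /forall_inP := forall_inP indep A AK; apply.
- exact: (skel_adj_K1_parts e_sym e_irr skelP CS iC).
- exact: (K1_parts_labelled_class e_sym e_irr skelP CS iC).
Qed.
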